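(* Let $n\ge2$ and $m\ge3$ be integers. The following are equivalent for maps $\phi_i:\langle\mathbf{DS}_n\rangle\to\langle\mathbf{DS}_n\rangle$ ($i=1,\ldots,m$): (1) $\operatorname{tr}(\phi_1(A_1)\phi_2(A_2)\cdots\phi_m(A_m))=\operatorname{tr}(A_1A_2\cdots A_m)$ for all $A_1,\ldots,A_m\in\langle\mathbf{DS}_n\rangle$. (2) $\operatorname{spec}(\phi_1(A_1)\phi_2(A_2)\cdots\phi_m(A_m))=\operatorname{spec}(A_1A_2\cdots A_m)$ for all $A_1,\ldots,A_m\in\langle\mathbf{DS}_n\rangle$. (3) When $n=2$, there exist $P\in\left\{I_2,\begin{pmatrix}1&0\\ 0&-1\end{pmatrix}\right\}$ and invertible matrices $Q_1,Q_2,\ldots,Q_m\in\langle\mathbf{DS}_2\rangle$ with $Q_1Q_2\cdots Q_m=I_2$ such that $$\phi_i(A)=PAP^{-1}Q_i\qquad\text{for all }A\in\langle\mathbf{DS}_2\rangle,\ i\in\{1,\ldots,m\};$$ more explicitly, either $\phi_i(A)=AQ_i$ for all $A\in\langle\mathbf{DS}_2\rangle$ and all $i\in\{1,\ldots,m\}$, or $\phi_i\left(\begin{pmatrix}a & b \\ b & a\end{pmatrix}\right)=\begin{pmatrix}a & -b \\ -b & a\end{pmatrix}Q_i$ for all $a,b\in\mathbb{R}$ and all $i\in\{1,\ldots,m\}$. When $n\ge3$, there are invertible matrices $P_1,P_2,\ldots,P_m,P_{m+1}$ in $\langle\mathbf{DS}_n\rangle$ with $P_{m+1}=P_1$ such that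 $$\phi_i(A)=P_iAP_{i+1}^{-1}\qquad\text{for all }A\in\langle\mathbf{DS}_n\rangle,\ i\in\{1,\ldots,m\}.$$
   Context: $\mathbf{DS}_n$ is the set of $n\times n$ doubly stochastic matrices (real, entrywise nonnegative, all row sums and all column sums equal to $1$). $\langle\mathbf{DS}_n\rangle$ is its real linear span; with $e=(1,\ldots,1)^t\in\mathbb{R}^n$, it equals $\{A\in M_n(\mathbb{R}): Ae=ce,\ e^tA=ce^t \text{ for some } c\in\mathbb{R}\}$. $\operatorname{spec}(A)$ is the spectrum (multiset of complex eigenvalues) of $A$ counting multiplicities. The maps $\phi_i$ are not assumed linear. *)

(* Defs.v *)
From mathcomp Require Import all_boot all_order all_algebra.
From mathcomp Require Import all_classical all_reals.
From mathcomp Require Import multiset.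
From mathcomp Require Import complex.

Set Implicit Arguments.
Unset Strict Implicit.
Unset Printing Implicit Defensive.

Import Order.TTheory GRing.Theory Num.Theory.

Local Open Scope classical_set_scope.
Local Open Scope ring_scope.

Definition doubly_stochastic (R : realType) (n : nat) : set 'M[R]_n :=
  [set A | [/\ forall i j, 0 <= A i j,
               forall i, \sum_j A i j = 1 &
               forall j, \sum_i A i j = 1]].

(* As a set, [DSspan R n] also coerces to the type of its elements; an element
   of that type coerces back to a matrix through [\val]. *)
Definition DSspan (R : realType) (n : nat) : set 'M[R]_n :=
  [set A | exists k (c : 'I_k -> R) (D : 'I_k -> 'M[R]_n),
      (forall i, doubly_stochastic (D i)) /\ A = \sum_i c i *: D i].

Arguments DSspan : clear implicits.

(* The characteristic polynomial is monic, so the sequence provided by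
   [closed_field_poly_normal] lists all its complex roots, with multiplicity. *)
Definition spec (R : realType) (n : nat) (A : 'M[R]_n) : {mset R[i]}%mset :=
  seq_mset (sval (closed_field_poly_normal
    (char_poly (map_mx (real_complex R) A)))).

(* The product A_1 A_2 ... A_m, in this order. *)
Definition mxprod (R : realType) (n m : nat) (A : 'I_m -> 'M[R]_n) : 'M[R]_n :=
  \big[mulmx/1%:M]_(i < m) A i.

Definition mx2 (R : realType) (a b c d : R) : 'M[R]_2 :=
  \matrix_(i, j) if i == 0 then (if j == 0 then a else b)
                 else (if j == 0 then c else d).

Section Conditions.
Variables (R : realType) (m : nat).

Definition trace_preserving n (phi : 'I_m -> DSspan R n -> DSspan R n) : Prop :=
  forall A : 'I_m -> DSspan R n,
    \tr (mxprod (fun i => \val (phi i (A i)))) =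
    \tr (mxprod (fun i => \val (A i))).

Definition spec_preserving n (phi : 'I_m -> DSspan R n -> DSspan R n) : Prop :=
  forall A : 'I_m -> DSspan R n,
    spec (mxprod (fun i => \val (phi i (A i)))) =
    spec (mxprod (fun i => \val (A i))).

Definition form2 (phi : 'I_m -> DSspan R 2 -> DSspan R 2) : Prop :=
  exists (P : 'M[R]_2) (Q : 'I_m -> DSspan R 2),
    [/\ P = 1%:M \/ P = mx2 1 0 0 (-1),
        forall i, \val (Q i) \in unitmx,
        mxprod (fun i => \val (Q i)) = 1%:M &
        forall i (A : DSspan R 2),
          \val (phi i A) = P *m \val A *m invmx P *m \val (Q i)].

Definition form2_explicit (phi : 'I_m -> DSspan R 2 -> DSspan R 2) : Prop :=
  exists Q : 'I_m -> DSspan R 2,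
    [/\ forall i, \val (Q i) \in unitmx,
        mxprod (fun i => \val (Q i)) = 1%:M &
        (forall i (A : DSspan R 2), \val (phi i A) = \val A *m \val (Q i)) \/
        (forall i (A : DSspan R 2) (a b : R), \val A = mx2 a b b a ->
           \val (phi i A) = mx2 a (- b) (- b) a *m \val (Q i))].

(* [P] lists P_1, ..., P_(m+1): for i : 'I_m, [widen_ord (leqnSn m) i] and
   [lift ord0 i] are the indices i and i + 1 in 'I_(m+1). *)
Definition form3 n (phi : 'I_m -> DSspan R n -> DSspan R n) : Prop :=
  exists P : 'I_m.+1 -> DSspan R n,
    [/\ forall i, \val (P i) \in unitmx,
        P ord_max = P ord0 &
        forall i (A : DSspan R n),
          \val (phi i A) =
          \val (P (widen_ord (leqnSn m) i)) *m \val A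
            *m invmx (\val (P (lift ord0 i)))].

(* Only used for n >= 2, so that the last branch stands for n >= 3. *)
Definition standard_form n :
    ('I_m -> DSspan R n -> DSspan R n) -> Prop :=
  match n with
  | 2 => form2
  | n' => @form3 n'
  end.

Definition standard_form_explicit n :
    ('I_m -> DSspan R n -> DSspan R n) -> Prop :=
  match n with
  | 2 => form2_explicit
  | n' => @form3 n'
  end.

End Conditions.

(* Main.v *)
Require Import Defs.
From mathcomp Require Import all_boot all_order all_algebra.
From mathcomp Require Import all_classical all_reals.
From mathcomp Require Import multiset complex ring lra.

(** Let J be the matrix with all entries 1/n. The span of the doubly stochastic
    matrices is the centralizer of the idempotent J ([DSspanE]), hence an
    algebra isomorphic to R x M_(n-1)(R), on which the trace form (A, B) |->
    tr (A B) is nondegenerate ([tr_nondegenerate]).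

    From the trace identity to linearity. Rotating the product under the trace,
    any index can be put first; setting all but two or three of the arguments
    to 1 leaves identities such as tr (f A * X * g B * Y) = tr (A * B) with X
    and Y fixed. Two maps that are dual to each other in this sense are
    automatically linear and bijective, because the matrix of one is the
    inverse transpose of the matrix of the other ([linear_of_dual_rows]); and
    X, Y are invertible, because X * g B * Y takes the value 1
    ([trace_pairing]). So, for the periodic sequence f_0, f_1, ... that repeats
    the given maps, every f_i is a linear bijection and every f_i(1) is
    invertible.

    From linearity to an automorphism. In the identity
    tr (f_i A * f_(i+1) B * f_(i+2) C * V) = tr (A * B * C), where V is fixed and
    invertible, f_(i+2) C is arbitrary; so f_i A * f_(i+1) B depends on A * B
    only ([chain_mul]). Hence, with Q_i = f_0(1) ... f_(i-1)(1), there is one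
    algebra automorphism psi such that f_i A = Q_i^-1 * psi A * Q_(i+1) for all i
    ([chain_structure]). If psi preserves the trace then
    tr (psi A * Q_m) = tr A = tr (psi A) for all A, and Q_m = 1 ([trace_chain]).

    Automorphisms. For n >= 3 the two factors of R x M_(n-1)(R) have different
    dimensions, so psi J = J ([automorphism_avg]), and the Skolem-Noether
    argument gives psi A = U^-1 * A * U ([automorphism_inner]); then
    P_i = Q_i^-1 * U^-1 is as required. For n = 2 the algebra R x R has one more
    automorphism, the exchange of the factors, which is the conjugation by
    diag(1, -1) ([automorphism2]); as the algebra is commutative,
    f_i A = psi A * f_i(1).

    Conversely, the standard forms make the product of the f_i(A_i) similar
    to the product of the A_i, so that the spectra agree; and the spectrum
    determines the trace. *)

Set Implicit Arguments.
Unset Strict Implicit.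
Unset Printing Implicit Defensive.

Import Order.TTheory GRing.Theory Num.Theory.
Local Open Scope ring_scope.

(** * Duality forces linearity *)

(** With F and G the matrices whose rows are the images under [f] and [g] of the
    unit vectors, the hypothesis gives F * G^T = 1 and f x * G^T = x, so that
    [f] is the multiplication by the inverse of G^T, although neither map was
    assumed additive. *)
Lemma linear_of_dual_rows (F : fieldType) N (f g : 'rV[F]_N -> 'rV[F]_N) :
  (forall x y, f x *m (g y)^T = x *m y^T) ->
  exists2 K : 'M[F]_N, K \in unitmx & forall x, f x = x *m K.
Proof.
move=> fg; pose G : 'M[F]_N := \matrix_i g (delta_mx 0 i).
have fG x : f x *m G^T = x.
  apply/rowP => j.
  have -> : (f x *m G^T) 0 j = (f x *m (g (delta_mx 0 j))^T) 0 0.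
    by rewrite !mxE; apply: eq_bigr => k _; rewrite !mxE.
  rewrite fg trmx_delta mxE (bigD1 j) //= big1 ?addr0 => [|k neq_kj].
    by rewrite mxE !eqxx mulr1.
  by rewrite mxE (negPf neq_kj) mulr0.
have GV : (\matrix_i f (delta_mx 0 i)) *m G^T = 1%:M.
  by apply/row_matrixP => i; rewrite row_mul rowK fG rowE mulmx1.
have [_ Gu] := mulmx1_unit GV.
by exists (invmx G^T) => [|x]; rewrite ?unitmx_inv // -{2}(fG x) mulmxK.
Qed.

Lemma mxtrace_mulmx_mxvec (F : fieldType) n (A B : 'M[F]_n) :
  \tr (A *m B) = (mxvec A *m (mxvec B^T)^T) 0 0.
Proof.
rewrite /mxtrace; under eq_bigr do rewrite mxE.
rewrite pair_bigA mxE (reindex _ (curry_mxvec_bij _ _)) /=.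
by apply: eq_bigr => -[i j] _ /=; rewrite [in RHS]mxE !mxvecE mxE.
Qed.

(** The trace form is the dot product of A and the transpose of B, both
    flattened, which reduces the claim to row vectors. *)
Lemma linear_of_trace_dual (F : fieldType) n (f g : 'M[F]_n -> 'M[F]_n) :
  (forall A B, \tr (f A *m g B) = \tr (A *m B)) ->
  exists2 h : {linear 'M[F]_n -> 'M[F]_n}, bijective h & f =1 h.
Proof.
move=> fg.
pose f' x := mxvec (f (vec_mx x)); pose g' y := mxvec (g (vec_mx y)^T)^T.
have [x y|K Ku f'K] := @linear_of_dual_rows F (n * n) f' g'.
  apply/rowP => i; rewrite ord1 -[X in _ = (X *m _) _ _]vec_mxK.
  rewrite -[X in _ = (_ *m X^T) _ _]vec_mxK -[vec_mx y]trmxK.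
  by rewrite -[RHS]mxtrace_mulmx_mxvec -fg mxtrace_mulmx_mxvec.
exists (vec_mx \o mulmxr K \o mxvec : {linear _ -> _}) => /=.
  by exists (vec_mx \o mulmxr (invmx K) \o mxvec) => A /=;
    rewrite vec_mxK ?mulmxK ?mulmxKV // mxvecK.
by move=> A /=; rewrite -f'K /f' !mxvecK.
Qed.

(** * The trace form on the centralizer of an idempotent *)

(** The Peirce projection of the ring onto the centralizer of the idempotent
    [e]: it forgets the two off-diagonal blocks. *)
Definition corner (R : pzRingType) (e x : R) : R :=
  e * x * e + (1 - e) * x * (1 - e).

Lemma cornerB (R : pzRingType) (e x y : R) :
  corner e (x - y) = corner e x - corner e y.
Proof.
by rewrite /corner; move: (1 - e) => c; rewrite !(mulrBr, mulrBl) opprD addrACA.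
Qed.

Section Corner.
Variables (R : pzRingType) (e : R).
Hypothesis ee : e * e = e.

Let eC : e * (1 - e) = 0. Proof. by rewrite mulrBr ee mulr1 subrr. Qed.
Let Ce : (1 - e) * e = 0. Proof. by rewrite mulrBl ee mul1r subrr. Qed.

Lemma comm_corner x : GRing.comm e (corner e x).
Proof.
rewrite /GRing.comm /corner [LHS]mulrDr [RHS]mulrDl !mulrA ee eC !mul0r.
by rewrite -[in RHS](mulrA _ e e) -(mulrA _ (1 - e) e) ee Ce mulr0.
Qed.

Lemma corner_id x : GRing.comm e x -> corner e x = x.
Proof.
move=> ex; have cx : GRing.comm (1 - e) x.
  by apply/commr_sym/commrB; [exact: commr1|exact: commr_sym].
have CC : (1 - e) * (1 - e) = 1 - e by rewrite mulrBr mulr1 Ce subr0.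
rewrite /corner ex cx -!mulrA ee CC.
by rewrite -mulrDr addrC subrK mulr1.
Qed.
End Corner.

Section Trace.
Variables (F : fieldType) (n : nat).
Implicit Types A B X Y Z : 'M[F]_n.+1.

Lemma tr_mulC A B : \tr (A * B) = \tr (B * A).
Proof. by rewrite -!mulmxE mxtrace_mulC. Qed.

(** The off-diagonal blocks are orthogonal, for the trace form, to everything
    that commutes with [e]. *)
Lemma tr_corner (e : 'M[F]_n.+1) (ee : e * e = e) Z A :
  GRing.comm e Z -> \tr (Z * corner e A) = \tr (Z * A).
Proof.
move=> eZ; have cZ : GRing.comm (1 - e) Z.
  by apply/commr_sym/commrB; [exact: commr1|exact: commr_sym].
have cc : (1 - e) * (1 - e) = 1 - e.
  by rewrite mulrBr mulr1 mulrBl mul1r ee subrr subr0.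
rewrite /corner mulrDr mxtraceD !mulrA tr_mulC [X in _ + X]tr_mulC !mulrA.
rewrite eZ cZ -[in X in X + _](mulrA Z) -[in X in _ + X](mulrA Z) ee cc.
by rewrite -mxtraceD -mulrDl -mulrDr addrC subrK mulr1.
Qed.

Lemma tr_nondegenerate (e : 'M[F]_n.+1) (ee : e * e = e) Z :
  GRing.comm e Z -> (forall A, GRing.comm e A -> \tr (Z * A) = 0) -> Z = 0.
Proof.
move=> eZ Z0; apply/matrixP => i j; rewrite mxE.
have /(_ (delta_mx j i)) : forall A, \tr (Z * A) = 0.
  by move=> A; rewrite -(tr_corner ee A eZ) Z0 //; apply: comm_corner.
rewrite /mxtrace (bigD1 i) //= big1 ?addr0 => [|k neq_ki].
  rewrite -mulmxE mxE (bigD1 j) //= big1 ?addr0 => [|k neq_kj].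
    by rewrite mxE !eqxx mulr1.
  by rewrite mxE (negPf neq_kj) mulr0.
by rewrite -mulmxE mxE big1 // => l _; rewrite mxE (negPf neq_ki) andbF mulr0.
Qed.

(** The duality principle for maps on the centralizer of [e]. Both maps are
    extended by the identity on the off-diagonal blocks; the extensions are
    dual on the full matrix algebra, because the two kinds of blocks are
    orthogonal. *)
Lemma linear_of_trace_dual_on (e : 'M[F]_n.+1) (ee : e * e = e)
    (f g : 'M[F]_n.+1 -> 'M[F]_n.+1) :
  (forall A, GRing.comm e A -> GRing.comm e (f A)) ->
  (forall A, GRing.comm e A -> GRing.comm e (g A)) ->
  (forall A B, GRing.comm e A -> GRing.comm e B ->
     \tr (f A * g B) = \tr (A * B)) ->
  exists h : {linear 'M[F]_n.+1 -> 'M[F]_n.+1},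
    [/\ injective h, forall A, GRing.comm e A -> f A = h A
      & forall Z, GRing.comm e Z -> exists2 A, GRing.comm e A & h A = Z].
Proof.
move=> fe ge fg; pose p := corner e.
have pe A : GRing.comm e (p A) by exact: comm_corner.
pose ext (k : 'M[F]_n.+1 -> 'M[F]_n.+1) A := k (p A) + (A - p A).
have [|h [h' hK h'K] fh] := @linear_of_trace_dual F n.+1 (ext f) (ext g).
  have tr0 Z A : GRing.comm e Z -> \tr (Z * (A - p A)) = 0.
    by move=> eZ; rewrite mulrBr linearB /= tr_corner // subrr.
  move=> A B; rewrite mulmxE /ext mulrDl 2!(mulrDr _ _ (B - _)) !mxtraceD.
  rewrite fg // (tr0 (f _)) ?addr0; last exact: fe.
  rewrite [\tr ((A - p A) * g _)]tr_mulC tr0 ?add0r; last exact: ge.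
  rewrite tr_corner // mulrBr linearB /=.
  rewrite [\tr ((A - p A) * p B)]tr_mulC tr0 // subr0.
  rewrite tr_mulC [\tr ((A - p A) * B)]tr_mulC -mxtraceD -mulrDr.
  by rewrite addrC subrK tr_mulC.
have pid A : GRing.comm e A -> p A = A by exact: corner_id.
exists h; split=> [||Z eZ]; first exact: can_inj hK.
  by move=> A eA; rewrite -fh /ext pid // subrr addr0.
(* The off-diagonal part of the preimage X of Z is Z - f (p X), which commutes
   with e; so it vanishes. *)
set X := h' Z; have hX : f (p X) + (X - p X) = Z by rewrite -(h'K Z) -fh.
have : GRing.comm e (X - p X).
  rewrite -[X - p X](addKr (f (p X))) hX.
  by apply: commrD => //; apply/commrN/fe.
move=> /pid; rewrite /p cornerB -/p (pid (p X)) // subrr => pX.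
by exists (p X) => //; rewrite -fh /ext (pid (p X)) // subrr -hX -pX.
Qed.

End Trace.

(** * Families of maps with a three-fold trace identity *)

Lemma unitr_of_mul1 (F : fieldType) n (A B : 'M[F]_n.+1) :
  A * B = 1 -> A \is a GRing.unit /\ B \is a GRing.unit.
Proof. exact: (@mulmx1_unit F n.+1 A B). Qed.

(** Both [f] and B |-> X * g B * Y are linear bijections of the centralizer, by
    duality; the second one takes the value 1, so that X and Y are invertible. *)
Lemma trace_pairing (F : fieldType) n (e : 'M[F]_n.+1) (ee : e * e = e)
    (f g : 'M[F]_n.+1 -> 'M[F]_n.+1) (X Y : 'M[F]_n.+1) :
  (forall A, GRing.comm e A -> GRing.comm e (f A)) ->
  (forall A, GRing.comm e A -> GRing.comm e (g A)) ->
  GRing.comm e X -> GRing.comm e Y ->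
  (forall A B, GRing.comm e A -> GRing.comm e B ->
     \tr (f A * X * g B * Y) = \tr (A * B)) ->
  [/\ X \is a GRing.unit, Y \is a GRing.unit &
   exists h : {linear 'M[F]_n.+1 -> 'M[F]_n.+1},
    [/\ injective h, forall A, GRing.comm e A -> f A = h A
      & forall Z, GRing.comm e Z -> exists2 A, GRing.comm e A & h A = Z]].
Proof.
move=> fe ge eX eY fg.
have he B : GRing.comm e B -> GRing.comm e (X * g B * Y).
  by move=> eB; do 2!apply: commrM => //; exact: ge.
have fh A B : GRing.comm e A -> GRing.comm e B ->
    \tr (f A * (X * g B * Y)) = \tr (A * B).
  by move=> eA eB; rewrite !mulrA fg.
have hf A B : GRing.comm e A -> GRing.comm e B ->
    \tr (X * g A * Y * f B) = \tr (A * B).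
  by move=> eA eB; rewrite tr_mulC fh // tr_mulC.
have [k [_ gk kZ]] := linear_of_trace_dual_on ee he fe hf.
have [B eB] := kZ 1 (commr1 _); rewrite -gk // => B1.
have [_ Yu] := unitr_of_mul1 B1.
move: B1; rewrite -mulrA => /unitr_of_mul1[Xu _].
by split=> //; exact: (linear_of_trace_dual_on ee fe he fh).
Qed.

(** The restriction of [psi] to the centralizer of [e] is an algebra
    automorphism. Keeping [psi] defined and injective on all matrices lets it be
    an ordinary linear map. *)
Definition centralizer_automorphism (F : fieldType) n (e : 'M[F]_n.+1)
    (psi : {linear 'M[F]_n.+1 -> 'M[F]_n.+1}) : Prop :=
  [/\ injective psi,
      forall A, GRing.comm e A -> GRing.comm e (psi A),
      forall Z, GRing.comm e Z -> exists2 A, GRing.comm e A & psi A = Z,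
      forall A B, GRing.comm e A -> GRing.comm e B ->
        psi (A * B) = psi A * psi B &
      psi 1 = 1].

Section UnitProduct.
Variables (F : fieldType) (n : nat) (f : nat -> 'M[F]_n.+1 -> 'M[F]_n.+1).

Definition unit_prod i : 'M[F]_n.+1 := \prod_(0 <= k < i) f k 1.

Lemma unit_prod0 : unit_prod 0 = 1.
Proof. exact: big_geq. Qed.

Lemma unit_prodS i : unit_prod i.+1 = unit_prod i * f i 1.
Proof. by rewrite /unit_prod big_nat_recr. Qed.

Lemma unit_prod_unit i : (forall k, f k 1 \is a GRing.unit) ->
  unit_prod i \is a GRing.unit.
Proof.
move=> fu; elim: i => [|i IHi]; first by rewrite unit_prod0 unitr1.
by rewrite unit_prodS unitrMr.
Qed.

Lemma comm_unit_prod (e : 'M[F]_n.+1) i : (forall k, GRing.comm e (f k 1)) ->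
  GRing.comm e (unit_prod i).
Proof.
move=> fe; elim: i => [|i IHi]; first by rewrite unit_prod0; apply: commr1.
by rewrite unit_prodS; apply: commrM.
Qed.

End UnitProduct.

Section Chain.
Variables (F : fieldType) (n : nat) (e : 'M[F]_n.+1).
Hypothesis ee : e * e = e.
Variables (f : nat -> 'M[F]_n.+1 -> 'M[F]_n.+1) (V : nat -> 'M[F]_n.+1).
Hypothesis fe : forall i A, GRing.comm e A -> GRing.comm e (f i A).
Hypothesis eV : forall i, GRing.comm e (V i).
Hypothesis tr_f : forall i A B C,
  GRing.comm e A -> GRing.comm e B -> GRing.comm e C ->
  \tr (f i A * f i.+1 B * f i.+2 C * V i) = \tr (A * B * C).

Let e1 : GRing.comm e 1 := commr1 e.
Let fe1 i : GRing.comm e (f i 1). Proof. exact: fe. Qed.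

(** Here A = 1, and f_i(1) is rotated to the end of the product, next to [V i]. *)
Lemma chain_unit i : f i 1 \is a GRing.unit.
Proof.
have [||||A B eA eB|] :=
  @trace_pairing F n e ee (f i.+1) (f i.+2) 1 (V i * f i 1).
- exact: fe.
- exact: fe.
- exact: e1.
- exact: commrM.
- rewrite mulr1 mulrA tr_mulC !mulrA tr_f //.
  by rewrite mul1r.
by move=> _ + _; rewrite -[_ \is a _]/(_ \in unitmx) unitmx_mul => /andP[].
Qed.

Lemma chain_linear i : V i \is a GRing.unit /\
  exists h : {linear 'M[F]_n.+1 -> 'M[F]_n.+1},
    [/\ injective h, forall A, GRing.comm e A -> f i A = h A
      & forall Z, GRing.comm e Z -> exists2 A, GRing.comm e A & h A = Z].
Proof.
have [||||A B eA eB|//] :=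
  @trace_pairing F n e ee (f i) (f i.+2) (f i.+1 1) (V i).
- exact: fe.
- exact: fe.
- exact: fe1.
- exact: eV.
- by rewrite tr_f // mulr1.
Qed.

(** In the trace identity f_(i+2) C ranges over the whole centralizer, so that
    nondegeneracy determines V_i * f_i A * f_(i+1) B from A * B. *)
Lemma chain_mul i A B A' B' :
  GRing.comm e A -> GRing.comm e B -> GRing.comm e A' -> GRing.comm e B' ->
  A * B = A' * B' -> f i A * f i.+1 B = f i A' * f i.+1 B'.
Proof.
move=> eA eB eA' eB' AB; apply/eqP; rewrite -subr_eq0; apply/eqP.
have [Vu _] := chain_linear i; have [_ [h [_ fh hZ]]] := chain_linear i.+2.
have H Z : GRing.comm e Z ->
    \tr (V i * (f i A * f i.+1 B - f i A' * f i.+1 B') * Z) = 0.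
  move=> eZ; have [C eC CZ] := hZ Z eZ; rewrite -CZ -fh //.
  rewrite -mulrA tr_mulC !mulrBl linearB /= !tr_f // AB subrr //.
apply: (mulrI Vu); rewrite mulr0.
apply: (tr_nondegenerate ee) H.
by apply: commrM => //; apply: commrB; apply: commrM; exact: fe.
Qed.

(** The automorphism is psi A = f_0 A * f_0(1)^-1. Moving A from one slot to the
    next, f_i(1) * f_(i+1) A = f_i A * f_(i+1)(1), gives the formula for f_i by
    induction; the multiplicativity of psi is then the fact that f_0 A * f_1 B
    equals f_0 (A * B) * f_1(1). *)
Lemma chain_structure :
  exists2 psi : {linear 'M[F]_n.+1 -> 'M[F]_n.+1},
    centralizer_automorphism e psi &
    forall i A, GRing.comm e A ->
      f i A = (unit_prod f i)^-1 * psi A * unit_prod f i.+1.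
Proof.
have [_ [h [hI fh hZ]]] := chain_linear 0.
have u0 := chain_unit 0.
have Qu i : unit_prod f i \is a GRing.unit.
  by apply: unit_prod_unit => k; exact: chain_unit.
have formula i A : GRing.comm e A ->
    f i A = (unit_prod f i)^-1 * (f 0 A * (f 0 1)^-1) * unit_prod f i.+1.
  move=> eA; elim: i => [|i IHi].
    by rewrite unit_prodS unit_prod0 invr1 !mul1r divrK.
  apply: (mulrI (chain_unit i)).
  rewrite (@chain_mul i 1 A A 1) ?mul1r ?mulr1 //.
  rewrite IHi [in RHS]unit_prodS (unit_prodS _ i.+1) !mulrA.
  rewrite invrM ?chain_unit //.
  by rewrite !mulrA divrr ?chain_unit // mul1r.
exists (mulmxr (f 0 1)^-1 \o h : {linear _ -> _}) => [|i A eA].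
  split=> /=.
  - by move=> A B /= /(can_inj (mulrK _)) /hI -> //; rewrite unitrV.
  - move=> A eA.
    by rewrite -fh //; apply: commrM; [exact: fe|exact: commrV].
  - move=> Z eZ; have [|A eA hA] := hZ (Z * f 0 1); first exact: commrM.
    by exists A => //=; rewrite hA mulmxE mulrK.
  - move=> A B eA eB /=; have eAB : GRing.comm e (A * B) by exact: commrM.
    rewrite -!fh // !mulmxE mulrA; congr (_ / _).
    apply: (mulIr (chain_unit 1)).
    rewrite -(@chain_mul 0 A B (A * B) 1) ?mulr1 // (formula 1%N B) //.
    rewrite !unit_prodS unit_prod0 !mul1r !mulrA.
    by rewrite divrK.
  - by rewrite -fh // mulmxE divrr.
by rewrite formula // fh.
Qed.
End Chain.

(** * Automorphisms of the centralizer of the averaging matrix *)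

Section Averaging.
Variables (F : numFieldType) (n : nat).

Definition avg : 'M[F]_n.+1 := const_mx n.+1%:R^-1.
Local Notation J := avg.
Local Notation K := (1 - avg).

Lemma mul_avg_mul (X : 'M[F]_n.+1) : J * X * J = \tr (X * J) *: J.
Proof.
apply/matrixP => i j; rewrite -!mulmxE !mxE.
under eq_bigr do rewrite !mxE.
rewrite -mulr_suml; congr (_ * _); rewrite exchange_big /=.
rewrite /mxtrace; apply: eq_bigr => k _; rewrite [RHS]mxE.
by apply: eq_bigr => l _; rewrite !mxE mulrC.
Qed.

Lemma tr_avg : \tr J = 1.
Proof.
rewrite /mxtrace; under eq_bigr do rewrite mxE.
by rewrite sumr_const card_ord -[LHS]mulr_natl divff // pnatr_eq0.
Qed.

Lemma avg_idem : J * J = J.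
Proof. by have := mul_avg_mul 1; rewrite mulr1 mul1r tr_avg scale1r. Qed.

Lemma avg_neq0 : J != 0.
Proof.
apply/eqP => J0; have := tr_avg; rewrite J0 linear0 => /esym/eqP.
by rewrite oner_eq0.
Qed.

Lemma comm_avgE A : GRing.comm J A -> A * J = \tr (A * J) *: J.
Proof. by move=> JA; rewrite -mul_avg_mul JA -mulrA avg_idem. Qed.

Lemma rank_avg_le1 : (\rank J <= 1)%N.
Proof.
have -> : J = (const_mx n.+1%:R^-1 : 'cV_n.+1) *m (const_mx 1 : 'rV_n.+1).
  by apply/matrixP => i j; rewrite !mxE big_ord1 !mxE mulr1.
exact: mulmx_max_rank.
Qed.

Let KK : K * K = K.
Proof. by rewrite mulrBr mulr1 mulrBl mul1r avg_idem subrr subr0. Qed.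
Let KJ : K * J = 0. Proof. by rewrite mulrBl mul1r avg_idem subrr. Qed.
Let JK : J * K = 0. Proof. by rewrite mulrBr mulr1 avg_idem subrr. Qed.

Lemma comm_avg_KXK X : GRing.comm J (K * X * K).
Proof. by rewrite /GRing.comm !mulrA JK !mul0r -(mulrA _ K J) KJ mulr0. Qed.

Lemma comm_avgK A : GRing.comm J A -> K * A = A * K.
Proof. by move=> JA; rewrite mulrBl mulrBr mul1r mulr1 JA. Qed.

Section Automorphism.
Variable psi : {linear 'M[F]_n.+1 -> 'M[F]_n.+1}.
Hypothesis psi_aut : centralizer_automorphism J psi.

(** The idempotent E = psi J generates a one-dimensional ideal, like J, so that
    E * J is proportional to both. If it is nonzero then E is proportional to J,
    hence equal to it. If E * J = 0 then E * X * K = E * (K X K) is proportional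
    to E for all X, where K = 1 - J; with X a matrix unit, this makes every row
    of K proportional to one row of E. Then K has rank at most 1, which is absurd
    when n.+1 = rank (K + J) is at least 3. *)
Lemma automorphism_avg : (1 < n)%N -> psi J = J.
Proof.
case: psi_aut => psi_inj psi_comm psi_surj psiM _ n_gt1.
have JJ : GRing.comm J J by [].
set E := psi J.
have E0 : E != 0 by rewrite -(linear0 psi) (inj_eq psi_inj) avg_neq0.
have EZ Z : GRing.comm J Z -> exists c, E * Z = c *: E.
  move=> /psi_surj[A JA <-]; exists (\tr (A * J)).
  by rewrite /E -psiM // -linearZ -comm_avgE // JA.
have JE : GRing.comm J E by exact: psi_comm.
have [c EJ] := EZ J JJ; have := comm_avgE JE; rewrite [LHS]EJ.
have [c0|c0] := eqVneq c 0 => [_|cE].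
  exfalso.
  rewrite c0 scale0r in EJ.
  have [[a b] /= Eab] : exists p, E p.1 p.2 != 0.
    apply/existsP; apply: contraNT E0 => /existsPn E0; apply/eqP/matrixP => i j.
    by rewrite mxE; apply/eqP; have := E0 (i, j); rewrite negbK.
  have subK : (K <= row a E)%MS.
    apply/row_subP => k.
    have [d Ed] := EZ _ (comm_avg_KXK (delta_mx b k)).
    have -> : row k K = (d / E a b) *: row a E.
      rewrite mulrC -scalerA.
      have <- : row a (d *: E) = d *: row a E by rewrite linearZ.
      rewrite -Ed !mulrA (mulrBr E) mulr1 EJ subr0 -!mulmxE.
      rewrite row_mul row_mul [row k K]rowE.
      have -> : row a E *m delta_mx b k = E a b *: delta_mx 0 k.
        apply/rowP => j; rewrite !mxE (bigD1 b) //= big1 ?addr0.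
          by rewrite !mxE !eqxx.
        by move=> l lb; rewrite !mxE (negPf lb) mulr0.
      by rewrite -scalemxAl scalerA mulVf // scale1r.
    exact: scalemx_sub.
  have := mxrank_add K J; rewrite subrK mxrank1 leqNgt => /negP; apply.
  rewrite ltnS; apply: leq_trans n_gt1; apply: (@leq_add _ _ 1 1) rank_avg_le1.
  by rewrite // (leq_trans (mxrankS subK)) // rank_leq_row.
have : E * E = E by rewrite /E -psiM // avg_idem.
have {}cE : E = (\tr (E * J) / c) *: J.
  by rewrite mulrC -scalerA -cE scalerA mulVf // scale1r.
set d := _ / _ in cE.
have d0 : d != 0 by apply: contra E0 => /eqP d0; rewrite cE d0 scale0r.
rewrite cE -scalerAl -scalerAr avg_idem scalerA => /eqP.
rewrite -subr_eq0 -scalerBl scaler_eq0 (negPf avg_neq0) orbF subr_eq0.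
rewrite -[X in _ == X]mulr1 => /eqP/(mulfI d0) ->.
by rewrite scale1r.
Qed.

(** The Skolem-Noether argument, for row vectors. Fix a column [v] and a row [u]
    of sum zero with u *m v != 0, and a row [y] not killed by psi (v *m u). The
    map T x = y *m psi (v *m x *m K) satisfies T (x *m A) = T x *m psi A, and it
    is injective on the rows of sum zero, because any nonzero one is moved to
    [u] by some A. Adding J makes it an invertible matrix U with
    A * U = U * psi A. *)
Lemma automorphism_inner : psi J = J -> (0 < n)%N ->
  exists U, [/\ U \is a GRing.unit, GRing.comm J U &
    forall A, GRing.comm J A -> psi A = U^-1 * A * U].
Proof.
case: psi_aut => psi_inj psi_comm psi_surj psiM _ psiJ n_gt0.
have [v [u [Kv uK uv]]] : exists (v : 'cV[F]_n.+1) (u : 'rV[F]_n.+1),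
  [/\ K *m v = v, u *m K = u & u *m v != 0].
  exists (K *m delta_mx 0 0), (delta_mx 0 0 *m K); split.
  - by rewrite mulmxA [K *m K]KK.
  - by rewrite -mulmxA [K *m K]KK.
  rewrite mulmxA -(mulmxA _ K K) [K *m K]KK -colE -rowE.
  apply/eqP => /matrixP/(_ 0 0)/eqP; rewrite !mxE eqxx.
  by rewrite subr_eq0 eq_sym invr_eq1 pnatr_eq1 eqSS gtn_eqF.
have JKXK (w : 'rV[F]_n.+1) : GRing.comm J (v *m w *m K).
  by rewrite -Kv -(mulmxA _ v w); exact: (comm_avg_KXK (v *m w)).
have vu0 : v *m u != 0.
  apply: contra uv => /eqP vu; apply/eqP.
  have : (u *m v) *m (u *m v) = 0.
    by rewrite mulmxA -(mulmxA u) vu mulmx0 mul0mx.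
  rewrite (mx11_scalar (u *m v)) -scalar_mxM => /matrixP/(_ 0 0)/eqP.
  rewrite !mxE eqxx mulr1n mulf_eq0 orbb => /eqP ->.
  by apply/matrixP => i j; rewrite !mxE mul0rn.
have [y yvu] : exists y : 'rV[F]_n.+1, y *m psi (v *m u) != 0.
  have : psi (v *m u) != 0 by rewrite -(linear0 psi) (inj_eq psi_inj).
  by move=> /rowV0Pn[z /submxP[y ->] ]; exists y.
pose T : {linear 'rV[F]_n.+1 -> 'rV[F]_n.+1} :=
  mulmx y \o psi \o mulmxr K \o mulmx v.
pose U := J + lin1_mx T.
have UE x : x *m U = x *m J + y *m psi (v *m x *m K).
  by rewrite mulmxDr mul_rV_lin1.
have psiKJ x : psi (v *m x *m K) *m J = 0.
  have := psiM _ _ (JKXK x) (erefl : GRing.comm J J).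
  by rewrite psiJ -!mulmxE -(mulmxA _ K) [K *m J]KJ mulmx0 linear0 => <-.
have UJ : U * J = J.
  apply/row_matrixP => i; rewrite rowE -mulmxE mulmxA UE mulmxDl.
  rewrite -[_ *m psi _ *m _]mulmxA psiKJ mulmx0 addr0.
  by rewrite -mulmxA [J *m J]avg_idem -rowE.
have JU : GRing.comm J U.
  rewrite /GRing.comm UJ; apply/row_matrixP => i; rewrite -mulmxE row_mul UE.
  rewrite -row_mul [J *m J]avg_idem -mulmxA -row_mul [J *m K]JK.
  by rewrite row0 mulmx0 linear0 mulmx0 addr0.
have UA A : GRing.comm J A -> A * U = U * psi A.
  move=> JA; apply/row_matrixP => i; rewrite !rowE -!mulmxE !mulmxA !UE.
  set x := delta_mx 0 i.
  have psiA : psi (v *m x *m K) *m psi A = psi (v *m x *m K *m A).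
    exact: esym (psiM _ _ (JKXK x) JA).
  rewrite mulmxDl -(mulmxA y) psiA -!mulmxA; congr (x *m _ + y *m psi _).
    have [dA Jd] : J * psi A = psi (J * A) /\ J * A = \tr (A * J) *: J.
      by split; [rewrite psiM ?psiJ | rewrite JA -comm_avgE].
    by rewrite [A *m J]comm_avgE // [J *m psi A]dA Jd linearZ /= psiJ.
  by rewrite [K *m A]comm_avgK.
have Uu : U \is a GRing.unit.
  rewrite -[_ \is a _]/(_ \in unitmx) -row_free_unit.
  apply: inj_row_free => x xU.
  have xJ : x *m J = 0 by rewrite -UJ -mulmxE mulmxA xU mul0mx.
  apply/rowP => j; rewrite mxE; apply/eqP/contraT => xj.
  (* The row x has sum zero, and this A maps it to a nonzero multiple of u. *)
  pose A := K * (delta_mx j 0 *m u) * K.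
  have JA : GRing.comm J A by exact: comm_avg_KXK.
  have xA : v *m x *m K *m A = x 0 j *: (v *m u).
    rewrite /A -!mulmxE -!mulmxA uK (mulmxA K K) [K *m K]KK (mulmxA x K).
    have -> : x *m K = x by rewrite mulmxBr mulmx1 xJ subr0.
    rewrite (mulmxA x) (_ : x *m delta_mx j 0 = (x 0 j)%:M).
      by rewrite mul_scalar_mx -scalemxAr.
    by rewrite -colE; apply/matrixP => a b; rewrite !ord1 !mxE eqxx mulr1n.
  have := yvu; rewrite -(inj_eq (scalerI xj)).
  rewrite scaler0 scalemxAr -linearZ -xA.
  rewrite [psi _](psiM _ _ (JKXK x) JA) [y *m _]mulmxA.
  by move: xU; rewrite UE xJ add0r => ->; rewrite mul0mx eqxx.
by exists U; split=> // A JA; rewrite -mulrA UA // mulKr.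
Qed.
End Automorphism.
End Averaging.

(** * Rotating a periodic product under the trace *)

Section Cyclic.
Variables (F : numFieldType) (n m : nat).
Variable f : nat -> 'M[F]_n.+1 -> 'M[F]_n.+1.
Local Notation J := (avg F n).
Hypothesis m_ge3 : (3 <= m)%N.
Hypothesis f_per : forall i A, f (i + m) A = f i A.
Hypothesis f_comm : forall i A, GRing.comm J A -> GRing.comm J (f i A).
Hypothesis tr_prod :
  forall A : nat -> 'M[F]_n.+1, (forall k, GRing.comm J (A k)) ->
  \tr (\prod_(0 <= k < m) f k (A k)) = \tr (\prod_(0 <= k < m) A k).

(** Cyclicity of the trace moves the first factor, of index i, to the end, where
    by periodicity it may be given the index i + m. *)
Lemma tr_prod_shift i (A : nat -> 'M[F]_n.+1) :
  (forall k, GRing.comm J (A k)) ->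
  \tr (\prod_(i <= k < i + m) f k (A k)) = \tr (\prod_(i <= k < i + m) A k).
Proof.
elim: i A => [|i IHi] A JA; first by rewrite add0n tr_prod.
have lt_im : (i < i + m)%N by rewrite -addn1 leq_add2l (leq_trans _ m_ge3).
pose A' k := if k == i then A (i + m)%N else A k.
have JA' k : GRing.comm J (A' k) by rewrite /A'; case: eqP.
have := IHi A' JA'; rewrite !(big_ltn lt_im) {1 3}/A' eqxx.
have A'E k : (i.+1 <= k < i + m)%N -> A' k = A k.
  by rewrite /A'; case: eqP => // ->; rewrite ltnn.
under eq_big_nat => k /A'E -> do [].
under [X in _ = \tr (_ * X)]eq_big_nat => k /A'E -> do [].
by rewrite addSn !big_nat_recr //= f_per !(tr_mulC (A _)) !(tr_mulC (f i _)).
Qed.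

Lemma tr_prod3 i A B C :
  GRing.comm J A -> GRing.comm J B -> GRing.comm J C ->
  \tr (f i A * f i.+1 B * f i.+2 C * \prod_(i.+3 <= k < i + m) f k 1) =
  \tr (A * B * C).
Proof.
move=> JA JB JC.
pose Z k := if k == i then A else if k == i.+1 then B
            else if k == i.+2 then C else 1.
have JZ k : GRing.comm J (Z k).
  by rewrite /Z; do 3!case: eqP => // _; exact: commr1.
have Z1 k : (i.+3 <= k < i + m)%N -> Z k = 1.
  case/andP=> k3 _; have k2 := ltnW k3; have k1 := ltnW k2.
  by rewrite /Z !gtn_eqF.
have := tr_prod_shift i JZ.
have lt3 : (i.+2 < i + m)%N by rewrite -addn3 leq_add2l.
have lt2 := ltnW lt3; have lt1 := ltnW lt2.
rewrite !(big_ltn lt1) !(big_ltn lt2) !(big_ltn lt3).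
under eq_big_nat => k /Z1 -> do [].
under [X in _ = \tr (_ * (_ * (_ * X)))]eq_big_nat => k /Z1 -> do [].
rewrite big1_eq mulr1 /Z !eqxx !mulrA.
by rewrite !gtn_eqF // (leq_trans (ltnSn _)).
Qed.

Local Notation Q := (unit_prod f).

Let JV i : GRing.comm J (\prod_(i.+3 <= k < i + m) f k 1).
Proof.
by apply: big_ind => [||k _]; [exact: commr1|exact: commrM|exact/f_comm/commr1].
Qed.

Lemma trace_chain_unit i : f i 1 \is a GRing.unit.
Proof. exact: (chain_unit (avg_idem F n) f_comm JV tr_prod3 i). Qed.

Let Qu i : Q i \is a GRing.unit.
Proof. by apply: unit_prod_unit => k; exact: trace_chain_unit. Qed.

Let JQ i : GRing.comm J (Q i).
Proof. by apply: comm_unit_prod => k; exact/f_comm/commr1. Qed.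

(** The last clause compares tr (psi A) = tr A with tr (psi A * Q_m) = tr A, the
    trace identity with only one argument different from 1. *)
Lemma trace_chain :
  exists psi : {linear 'M[F]_n.+1 -> 'M[F]_n.+1},
  [/\ centralizer_automorphism J psi,
      forall i A, GRing.comm J A -> f i A = (Q i)^-1 * psi A * Q i.+1 &
      (forall A, GRing.comm J A -> \tr (psi A) = \tr A) -> Q m = 1].
Proof.
have [psi psi_aut psif] := chain_structure (avg_idem F n) f_comm JV tr_prod3.
exists psi; split=> // tr_psi; have [_ _ psiZ _ _] := psi_aut.
apply/eqP; rewrite -subr_eq0; apply/eqP.
apply: (tr_nondegenerate (avg_idem F n)) => [|Z /psiZ[A JA <-]].
  by apply: commrB => //; exact: commr1.
pose X k := if k == 0%N then A else 1.
have JX k : GRing.comm J (X k) by rewrite /X; case: eqP => // _; exact: commr1.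
have := tr_prod JX; have m_gt0 : (0 < m)%N by exact: leq_trans m_ge3.
rewrite !(big_ltn m_gt0) /=.
have X1 k : (1 <= k < m)%N -> X k = 1 by rewrite /X; case: k.
under eq_big_nat => k /X1 -> do [].
under [X in _ = \tr (_ * X)]eq_big_nat => k /X1 -> do [].
rewrite big1_eq mulr1 /X /= psif // unit_prod0 invr1 mul1r => trA.
rewrite mulrBl mul1r linearB /= tr_psi // -trA tr_mulC -mulrA.
rewrite /unit_prod (big_ltn m_gt0) big_nat1 subrr //.
Qed.

Lemma trace_chain_ge3 : (1 < n)%N ->
  exists P : nat -> 'M[F]_n.+1,
  [/\ forall i, P i \is a GRing.unit, forall i, GRing.comm J (P i),
      P m = P 0%N &
      forall i A, GRing.comm J A -> f i A = P i * A * (P i.+1)^-1].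
Proof.
move=> n_gt1.
have [psi [psi_aut psif Qm]] := trace_chain.
have psiJ := automorphism_avg psi_aut n_gt1.
have [U [Uu JU psiU]] := automorphism_inner psi_aut psiJ (ltnW n_gt1).
exists (fun i => (Q i)^-1 * U^-1); split=> [i|i||i A JA].
- by rewrite unitrMr unitrV.
- by apply: commrM; apply: commrV.
- rewrite Qm ?unit_prod0 // => A JA.
  by rewrite psiU // tr_mulC mulrA divrr // mul1r.
- rewrite psif // psiU // invrM ?unitrV // !invrK !mulrA //.
Qed.

End Cyclic.

(** * The spectrum and the characteristic polynomial *)

Section Spectrum.
Variable R : realType.

Lemma eq_spec n (A B : 'M[R]_n) : char_poly A = char_poly B -> spec A = spec B.
Proof. by move=> AB; rewrite /spec -!map_char_poly AB. Qed.

(** A monic polynomial that splits is the product of its linear factors; it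
    is then brought back from the complex numbers to R. *)
Lemma char_poly_of_spec n (A B : 'M[R]_n) :
  spec A = spec B -> char_poly A = char_poly B.
Proof.
move=> /eq_seq_msetP; case: closed_field_poly_normal => rA /= EA.
case: closed_field_poly_normal => rB /= EB /(perm_big _) rAB.
apply: (map_poly_inj (real_complex R)).
rewrite !map_char_poly EA EB !(monicP (char_poly_monic _)) !scale1r.
exact: rAB.
Qed.

Lemma tr_of_spec n (A B : 'M[R]_n.+1) : spec A = spec B -> \tr A = \tr B.
Proof.
move/char_poly_of_spec=> AB.
by apply: oppr_inj; rewrite -!char_poly_trace // AB.
Qed.

Lemma char_poly_conj n (U A V : 'M[R]_n) : U *m V = 1%:M ->
  char_poly (U *m A *m V) = char_poly A.
Proof.
move=> UV; rewrite /char_poly.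
have -> : char_poly_mx (U *m A *m V) =
    map_mx polyC U *m char_poly_mx A *m map_mx polyC V.
  rewrite /char_poly_mx mulmxBr mulmxBl -!map_mxM scalar_mxC.
  rewrite -(mulmxA _%:M) -map_mxM UV.
  by rewrite map_mx1 mulmx1.
rewrite !det_mulmx mulrAC -!det_mulmx -map_mxM UV map_mx1 mul1mx //.
Qed.

End Spectrum.

(** * The span of the doubly stochastic matrices *)

Section Span.
Variables (R : realType) (n : nat).
Local Notation J := (avg R n).

Lemma comm_avgP (A : 'M[R]_n.+1) :
  GRing.comm J A <->
  exists c, (forall i, \sum_j A i j = c) /\ (forall j, \sum_i A i j = c).
Proof.
have N0 : n.+1%:R^-1 != 0 :> R by rewrite invr_eq0 pnatr_eq0.
have JAE i j : (J * A) i j = n.+1%:R^-1 * \sum_k A k j.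
  by rewrite -mulmxE mxE mulr_sumr; apply: eq_bigr => k _; rewrite mxE.
have AJE i j : (A * J) i j = n.+1%:R^-1 * \sum_k A i k.
  by rewrite -mulmxE mxE mulr_sumr; apply: eq_bigr => k _; rewrite mxE mulrC.
split=> [JA|[c [rA cA]]]; last first.
  by apply/matrixP => i j; rewrite JAE AJE rA cA.
have E i j : \sum_k A k j = \sum_k A i k.
  by apply: (mulfI N0); rewrite -(AJE i j) -(JAE i j) JA.
exists (\sum_j A 0 j); split=> [i|j]; last exact: E.
by rewrite -(E i 0) (E 0).
Qed.

(** Let A be N x N, with all its row and column sums equal to c. For M large the
    matrix A + N M J is positive, hence it is t D with t = c + N M and D doubly
    stochastic; so A = t D - N M J is in the span. *)
Lemma DSspanE (A : 'M[R]_n.+1) : (A \in DSspan R n.+1) <-> GRing.comm J A.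
Proof.
split=> [/set_mem[k [c [D [DS ->]]]]|/comm_avgP[c [rA cA]]].
  apply: commr_sum => i _; have [_ rD cD] := DS i.
  rewrite /GRing.comm -scalerAl -scalerAr; congr (_ *: _).
  by apply/comm_avgP; exists 1.
apply: mem_set.
pose M : R := 1 + \sum_i \sum_j `|A i j|.
have AM i j : 0 < A i j + M.
  rewrite /M addrCA ltr_pwDl // -lerBlDl sub0r.
  rewrite (bigD1 i) //= (bigD1 j) //= -addrA.
  apply: le_trans (ler_norm _) _; rewrite normrN lerDl addr_ge0 // ?sumr_ge0 //.
  by move=> *; apply: sumr_ge0.
pose t := c + n.+1%:R * M.
have rE i : \sum_j (A i j + M) = t.
  by rewrite big_split /= rA sumr_const card_ord -[X in _ + X]mulr_natl.
have cE j : \sum_i (A i j + M) = t.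
  by rewrite big_split /= cA sumr_const card_ord -[X in _ + X]mulr_natl.
have t0 : 0 < t.
  rewrite -(rE 0) (bigD1 ord0) //= ltr_pwDl ?sumr_ge0 // => j _.
  exact: ltW.
pose D (k : 'I_2) : 'M[R]_n.+1 :=
  if k == 0 then t^-1 *: (A + const_mx M) else J.
exists 2%N, (fun k => if k == 0 then t else - (n.+1%:R * M)), D.
split=> [k|].
  rewrite /D; case: eqP => _; split=> [i j|i|j]; rewrite ?mxE.
  - by rewrite mulr_ge0 ?invr_ge0 // ltW.
  - under eq_bigr do rewrite !mxE.
    by rewrite -mulr_sumr rE mulVf ?gt_eqF.
  - under eq_bigr do rewrite !mxE.
    by rewrite -mulr_sumr cE mulVf ?gt_eqF.
  - by rewrite invr_ge0.
  - under eq_bigr do rewrite !mxE.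
    by rewrite sumr_const card_ord -[LHS]mulr_natl divff ?pnatr_eq0.
  - under eq_bigr do rewrite !mxE.
    by rewrite sumr_const card_ord -[LHS]mulr_natl divff ?pnatr_eq0.
rewrite big_ord_recl big_ord1 /= /D /= scalerA divff ?gt_eqF // scale1r.
apply/matrixP => i j; rewrite !mxE mulNr mulrAC divff ?pnatr_eq0 //.
by rewrite mul1r addrK.
Qed.

Lemma DSspan_comm (A : DSspan R n.+1) : GRing.comm J (\val A).
Proof. by apply/DSspanE; exact: valP. Qed.

Lemma DSspan1 : (1%:M : 'M[R]_n.+1) \in DSspan R n.+1.
Proof. by apply/DSspanE; exact: commr1. Qed.

(** Outside the span the value is a default, so that maps on the span can be
    handled as maps on all matrices. *)
Definition to_DS (A : 'M[R]_n.+1) : DSspan R n.+1 :=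
  insubd (exist (fun X => X \in DSspan R n.+1) 1%:M DSspan1) A.

Lemma to_DSK A : GRing.comm J A -> \val (to_DS A) = A.
Proof. by move=> /DSspanE AS; rewrite insubdK. Qed.

Lemma valK_DS (A : DSspan R n.+1) : to_DS (\val A) = A.
Proof. by apply: val_inj; rewrite to_DSK //; exact: DSspan_comm. Qed.

Lemma mxprodE m (A : 'I_m -> 'M[R]_n.+1) : mxprod A = \prod_i A i.
Proof. by []. Qed.

End Span.

(** * The case of 2 x 2 matrices *)

Section Two.
Variable R : realType.
Local Notation J := (avg R 1).

Lemma mx2E (A : 'M[R]_2) : A = mx2 (A 0 0) (A 0 1) (A 1 0) (A 1 1).
Proof.
apply/matrixP => i j; rewrite mxE.
case: i j => [[|[|//]] ?] [[|[|//]] ?] /=; congr (A _ _); exact: val_inj.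
Qed.

Lemma mx2_mul (a b c d a' b' c' d' : R) :
  mx2 a b c d * mx2 a' b' c' d' =
  mx2 (a * a' + b * c') (a * b' + b * d') (c * a' + d * c') (c * b' + d * d').
Proof.
apply/matrixP => i j; rewrite -mulmxE !mxE !big_ord_recl big_ord0 !mxE /= addr0.
by case: (i == 0); case: (j == 0).
Qed.

Lemma mx2_inj (a b c d a' b' c' d' : R) : mx2 a b c d = mx2 a' b' c' d' ->
  [/\ a = a', b = b', c = c' & d = d'].
Proof.
move=> E; split; first by have /matrixP/(_ 0 0) := E; rewrite !mxE.
- by have /matrixP/(_ 0 1) := E; rewrite !mxE.
- by have /matrixP/(_ 1 0) := E; rewrite !mxE.
- by have /matrixP/(_ 1 1) := E; rewrite !mxE.
Qed.

Lemma mx2_1 : 1 = mx2 1 0 0 1 :> 'M[R]_2.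
Proof. by rewrite [LHS]mx2E !mxE. Qed.

Lemma avg2E : J = mx2 2^-1 2^-1 2^-1 2^-1.
Proof. by rewrite [LHS]mx2E !mxE. Qed.

Lemma comm_avg2P (A : 'M[R]_2) : GRing.comm J A <-> exists a b, A = mx2 a b b a.
Proof.
rewrite avg2E; split=> [|[a [b ->]]]; last first.
  by rewrite /GRing.comm !mx2_mul; congr mx2; ring.
rewrite [A]mx2E /GRing.comm !mx2_mul => /mx2_inj[E1 E2 _ _].
exists (A 0 0), (A 0 1); congr mx2; lra.
Qed.

Lemma comm_avg2_mulC (A B : 'M[R]_2) :
  GRing.comm J A -> GRing.comm J B -> A * B = B * A.
Proof.
move=> /comm_avg2P[a [b ->]] /comm_avg2P[c [d ->]].
by rewrite !mx2_mul; congr mx2; ring.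
Qed.

Definition flip2 : 'M[R]_2 := mx2 1 0 0 (-1).

Lemma flip2_flip2 : flip2 * flip2 = 1.
Proof. by rewrite mx2_mul mx2_1; congr mx2; ring. Qed.

Lemma flip2_unit : flip2 \in unitmx.
Proof. by have [] := unitr_of_mul1 flip2_flip2. Qed.

Lemma flip2_conj a b :
  flip2 *m mx2 a b b a *m invmx flip2 = mx2 a (- b) (- b) a.
Proof.
apply: (canLR (mulmxK flip2_unit)); rewrite !mulmxE !mx2_mul.
by congr mx2; ring.
Qed.

(** The swap S = (0 1; 1 0) satisfies S^2 = 1, and the square roots of 1 in the
    algebra spanned by 1 and S are 1, -1, S and -S; by injectivity, psi S is
    S or -S. *)
Lemma automorphism2 (psi : {linear 'M[R]_2 -> 'M[R]_2}) :
  centralizer_automorphism J psi ->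
  (forall a b, psi (mx2 a b b a) = mx2 a b b a) \/
  (forall a b, psi (mx2 a b b a) = mx2 a (- b) (- b) a).
Proof.
move=> [psiI psi_c _ psiM psi1]; pose S : 'M[R]_2 := mx2 0 1 1 0.
have JS : GRing.comm J S by apply/comm_avg2P; exists 0, 1.
have psiE a b : psi (mx2 a b b a) = a *: 1 + b *: psi S.
  rewrite -[in RHS]psi1; have -> : mx2 a b b a = a *: 1 + b *: S.
    rewrite mx2_1; apply/matrixP => i j; rewrite !mxE.
    by case: (i == 0); case: (j == 0); ring.
  by rewrite linearD !linearZ.
have /comm_avg2P[x [y psiS]] := psi_c _ JS.
have SS : S * S = 1 by rewrite mx2_mul mx2_1; congr mx2; ring.
have : psi S * psi S = 1 by rewrite -psiM // SS.
rewrite psiS mx2_mul mx2_1 => /mx2_inj[xx xy _ _].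
have mxE2 a b : a *: 1 + b *: mx2 x y y x =
    mx2 (a + b * x) (b * y) (b * y) (a + b * x).
  rewrite mx2_1; apply/matrixP => i j; rewrite !mxE.
  by case: (i == 0); case: (j == 0); ring.
have y0 : y != 0.
  apply/eqP => y0.
  have /psiI/mx2_inj[_ /eqP] : psi S = psi (mx2 x 0 0 x).
    by rewrite psiS [RHS]psiE psiS mxE2 y0; congr mx2; ring.
  by rewrite oner_eq0.
have x0 : x = 0 by apply: (mulIf y0); lra.
have : (y - 1) * (y + 1) = 0 by rewrite x0 in xx; lra.
move=> /eqP; rewrite mulf_eq0 subr_eq0 addr_eq0 => /orP[] /eqP y1;
  [left|right] => a b; rewrite psiE psiS mxE2 x0 y1; congr mx2; ring.
Qed.

End Two.

(** * Trace preserving families on the span *)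

Section Assembly.
Variables (R : realType) (n m' : nat).
Local Notation m := m'.+1.
Local Notation J := (avg R n).
Variable phi : 'I_m -> DSspan R n.+1 -> DSspan R n.+1.

(** The maps phi_0, ..., phi_(m-1) repeated with period m, so that rotating a
    product is shifting its range of indices. *)
Definition periodic_ext (i : nat) (A : 'M[R]_n.+1) : 'M[R]_n.+1 :=
  \val (phi (inZp i) (to_DS A)).
Local Notation f := periodic_ext.

Lemma periodic_ext_per i A : f (i + m) A = f i A.
Proof.
by rewrite /f; congr (val (phi _ _)); apply: val_inj; rewrite /= modnDr.
Qed.

Lemma periodic_ext_comm i A : GRing.comm J A -> GRing.comm J (f i A).
Proof. by move=> _; exact: DSspan_comm. Qed.

Lemma periodic_ext_ord (i : 'I_m) (A : DSspan R n.+1) :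
  f i (\val A) = \val (phi i A).
Proof. by rewrite /f valZpK valK_DS. Qed.

Lemma periodic_ext_tr : trace_preserving phi ->
  forall A : nat -> 'M[R]_n.+1, (forall k, GRing.comm J (A k)) ->
  \tr (\prod_(0 <= k < m) f k (A k)) = \tr (\prod_(0 <= k < m) A k).
Proof.
move=> tr_phi A JA; rewrite !big_mkord.
transitivity (\tr (mxprod (fun i => \val (phi i (to_DS (A i)))))).
  by rewrite mxprodE; congr (\tr _); apply: eq_bigr => i _; rewrite /f valZpK.
by rewrite tr_phi mxprodE; congr (\tr _); apply: eq_bigr => i _; rewrite to_DSK.
Qed.

Lemma spec_preserving_tr : spec_preserving phi -> trace_preserving phi.
Proof. by move=> sp A; apply/tr_of_spec/sp. Qed.

Lemma form3_of_trace : (2 <= m')%N -> (1 < n)%N ->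
  trace_preserving phi -> form3 phi.
Proof.
move=> m_ge3 n_gt1 /periodic_ext_tr tr_f.
have [P [Pu JP Pm fP]] := trace_chain_ge3 (m_ge3 : (3 <= m)%N)
  periodic_ext_per periodic_ext_comm tr_f n_gt1.
exists (fun i => to_DS (P i)); split=> [i||i A].
- by rewrite to_DSK //; exact: Pu.
- by rewrite /= Pm.
by rewrite !to_DSK // -periodic_ext_ord fP //; exact: DSspan_comm.
Qed.

Lemma prod_conj (P A : nat -> 'M[R]_n.+1) k :
  (forall i, P i \is a GRing.unit) ->
  \prod_(0 <= i < k) (P i * A i * (P i.+1)^-1) =
  P 0%N * (\prod_(0 <= i < k) A i) * (P k)^-1.
Proof.
move=> Pu; elim: k => [|k IHk]; first by rewrite !big_geq // mulr1 divrr.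
by rewrite !big_nat_recr //= IHk !mulrA mulrVK.
Qed.

Lemma spec_of_form3 : form3 phi -> spec_preserving phi.
Proof.
move=> [P [Pu Pm phiP]] A; apply: eq_spec.
pose p k := \val (P (inord k)).
have pE (j : 'I_m.+1) k : j = k :> nat -> p k = \val (P j).
  by move=> <-; rewrite /p inord_val.
have -> : mxprod (fun i => \val (phi i (A i))) =
    p 0%N * (\prod_(0 <= i < m) \val (A (inord i))) * (p m)^-1.
  rewrite -prod_conj => [|i]; last exact: Pu.
  rewrite big_mkord mxprodE; apply: eq_bigr => i _.
  by rewrite phiP inord_val (pE (widen_ord (leqnSn m) i)) // (pE (lift ord0 i)).
rewrite (pE ord_max m) // Pm -(pE ord0 0%N) //.
rewrite char_poly_conj; last by apply: mulmxV; exact: Pu.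
congr char_poly; rewrite big_mkord mxprodE.
by apply: eq_bigr => i _; rewrite inord_val.
Qed.

End Assembly.

Section AssemblyTwo.
Variables (R : realType) (m' : nat).
Local Notation m := m'.+1.
Local Notation J := (avg R 1).
Variable phi : 'I_m -> DSspan R 2 -> DSspan R 2.

Lemma form2_explicitP : form2 phi <-> form2_explicit phi.
Proof.
split=> [[P [Q [PE Qu Q1 phiE]]]|[Q [Qu Q1 phiE]]].
  exists Q; split=> //; case: PE => PE.
    by left=> i A; rewrite phiE PE invmx1 mul1mx mulmx1.
  by right=> i A a b AE; rewrite phiE PE AE flip2_conj.
case: phiE => phiE.
  exists 1%:M, Q; split=> //; first by left.
  by move=> i A; rewrite phiE invmx1 mul1mx mulmx1.
exists (mx2 1 0 0 (-1)), Q; split=> //; first by right.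
move=> i A; have /comm_avg2P[a [b AE]] := DSspan_comm A.
by rewrite (phiE i A a b AE) AE flip2_conj.
Qed.

Lemma form2_of_trace : (2 <= m')%N -> trace_preserving phi -> form2 phi.
Proof.
move=> m_ge3 /periodic_ext_tr tr_f.
have f_per := periodic_ext_per phi.
have f_comm := @periodic_ext_comm _ _ _ phi.
have [psi [psi_aut fpsi Q1]] :=
  trace_chain (m_ge3 : (3 <= m)%N) f_per f_comm tr_f.
have f1_unit := trace_chain_unit (m_ge3 : (3 <= m)%N) f_per f_comm tr_f.
have [_ psi_c _ _ _] := psi_aut; have psi_form := automorphism2 psi_aut.
have {}Q1 : unit_prod (periodic_ext phi) m = 1.
  apply: Q1 => A /comm_avg2P[a [b ->]].
  case: psi_form => -> //.
  by rewrite /mxtrace !big_ord_recl !big_ord0 !mxE.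
have J1 : GRing.comm J 1 by exact: commr1.
apply/form2_explicitP; exists (fun i => to_DS (periodic_ext phi i 1)).
have JQ i : GRing.comm J (periodic_ext phi i 1) by exact: periodic_ext_comm.
split=> [i||].
- by rewrite to_DSK //; exact: f1_unit.
- rewrite mxprodE -[RHS]Q1 /unit_prod big_mkord; apply: eq_bigr => i _.
  by rewrite to_DSK.
have fE i A : GRing.comm J A ->
    periodic_ext phi i A = psi A * periodic_ext phi i 1.
  move=> JA; rewrite fpsi // unit_prodS -mulrA (mulrA (psi A)).
  have -> : psi A * unit_prod (periodic_ext phi) i =
            unit_prod (periodic_ext phi) i * psi A.
    by apply: comm_avg2_mulC; [exact: psi_c|exact: comm_unit_prod].
  by rewrite !mulrA mulVr ?mul1r //; exact: unit_prod_unit.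
case: psi_form => psiE; [left=> i A|right=> i A a b AE].
  have JA := DSspan_comm A; rewrite to_DSK // -periodic_ext_ord fE //.
  by have /comm_avg2P[a [b ->]] := JA; rewrite psiE.
rewrite to_DSK // -periodic_ext_ord fE ?AE ?psiE //.
by apply/comm_avg2P; exists a, b.
Qed.

Lemma prod_mul_comm2 (X Y : nat -> 'M[R]_2) k :
  (forall i, GRing.comm J (X i)) -> (forall i, GRing.comm J (Y i)) ->
  \prod_(0 <= i < k) (X i * Y i) =
  \prod_(0 <= i < k) X i * \prod_(0 <= i < k) Y i.
Proof.
move=> JX JY; elim: k => [|k IHk]; first by rewrite !big_geq // mulr1.
rewrite !big_nat_recr //= IHk -!mulrA; congr (_ * _).
rewrite !mulrA; congr (_ * _); apply: comm_avg2_mulC => //.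
by apply: big_ind => [||i _]; [exact: commr1|exact: commrM|].
Qed.

Lemma spec_of_form2 : form2 phi -> spec_preserving phi.
Proof.
move=> [P [Q [PE Qu Q1 phiE]]] A; apply: eq_spec.
have [Pu Pflip] : P \in unitmx /\
    forall B, GRing.comm J B -> GRing.comm J (P *m B *m invmx P).
  case: PE => ->.
    by split=> [|B JB]; rewrite ?unitmx1 // invmx1 mul1mx mulmx1.
  split=> [|B /comm_avg2P[a [b ->]]]; first exact: flip2_unit.
  by rewrite flip2_conj; apply/comm_avg2P; exists a, (- b).
pose X k := P * \val (A (inord k)) * P^-1; pose Y k := \val (Q (inord k)).
have -> : mxprod (fun i => \val (phi i (A i))) = \prod_(0 <= k < m) (X k * Y k).
  rewrite big_mkord mxprodE; apply: eq_bigr => i _.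
  by rewrite phiE /X /Y inord_val.
rewrite prod_mul_comm2; first last.
- by move=> k; exact: DSspan_comm.
- by move=> k; exact/Pflip/DSspan_comm.
have -> : \prod_(0 <= k < m) Y k = 1.
  rewrite -[RHS]Q1 big_mkord mxprodE.
  by apply: eq_bigr => i _; rewrite /Y inord_val.
rewrite mulr1 (@prod_conj R 1 (fun=> P)) // char_poly_conj ?mulmxV //.
by congr char_poly; rewrite big_mkord; apply: eq_bigr => i _; rewrite inord_val.
Qed.

End AssemblyTwo.

(** * The equivalence *)

Theorem theorem3p6 (R : realType) (n m : nat) (hn : (2 <= n)%N) (hm : (3 <= m)%N)
    (phi : 'I_m -> DSspan R n -> DSspan R n) :
  [<-> trace_preserving phi;
       spec_preserving phi;
       standard_form phi;
       standard_form_explicit phi].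
Proof.
case: m hm phi => // m m_ge3 phi.
have [to_std [std_spec explE]] : (trace_preserving phi -> standard_form phi) /\
    (standard_form phi -> spec_preserving phi) /\
    (standard_form phi <-> standard_form_explicit phi).
  case: n hn phi => [|[|[|n]]] // _ phi.
    split; first exact: form2_of_trace.
    by split; [exact: spec_of_form2|exact: form2_explicitP].
  split; first exact: form3_of_trace.
  by split; [exact: spec_of_form3|].
have spec_tr : spec_preserving phi -> trace_preserving phi.
  case: n hn phi {to_std std_spec explE} => // n _ phi.
  exact: spec_preserving_tr.
by tfae=> [/to_std/std_spec|/spec_tr/to_std|/explE|/explE/std_spec/spec_tr].
Qed.
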